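(* Let $\phi:\mathbb R\to[0,\infty)$ be even, continuous, non-decreasing on $[0,\infty)$, with $\phi(x)/|x|\to\infty$ as $|x|\to\infty$, and let $B\in\mathbb R$ with $\phi(0)<B$. For every $\Delta>0$ and every sequence of measurable estimators $\mu_n:\mathbb R^n\to\mathbb R$, $n\ge1$, $$\liminf_{n\to\infty}\frac1n\log\beta_n(\mu_n;\Delta)\;\ge\;-r(\Delta).$$
   Context: For $\mu\in\mathbb R$, $\mathcal C_\mu$ is the set of Borel probability measures $P$ on $\mathbb R$ with $\int x\,dP=\mu$ and $\int\phi(x-\mu)\,dP\le B$. The worst-case confidence level of an estimator $\mu_n=\mu_n(X_1,\dots,X_n)$ at margin $\Delta$ is $$\beta_n(\mu_n;\Delta)=\max\Bigl\{\sup_{\mu\in\mathbb R,\,P_\mu\in\mathcal C_\mu}P_\mu[\mu_n>\mu+\Delta],\ \sup_{\mu\in\mathbb R,\,P_\mu\in\mathcal C_\mu}P_\mu[\mu_n<\mu-\Delta]\Bigr\},$$ where under $P_\mu$ the observations $X_1,\dots,X_n$ are i.i.d. with law $P_\mu$. $r(\Delta):=-\log\sup\{\rho(P_-,P_+): P_-\in\mathcal C_{-\Delta},\,P_+\in\mathcal C_{\Delta}\}$, where $\rho(P_-,P_+)=\int\sqrt{dP_-\,dP_+}$ is the Hellinger affinity, i.e. $\int\sqrt{p_-p_+}\,d\omega$ with $p_\pm=dP_\pm/d\omega$ for any common dominating measure $\omega$. *)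

(* Defs.v *)
From HB Require Import structures.
From mathcomp Require Import all_boot all_order all_algebra.
From mathcomp Require Import all_classical all_reals all_analysis measurable_realfun.

Set Implicit Arguments.
Unset Strict Implicit.
Unset Printing Implicit Defensive.
Import Order.TTheory GRing.Theory Num.Theory.
Import numFieldNormedType.Exports.

Local Open Scope classical_set_scope.
Local Open Scope ring_scope.

Section cons_tuple.
Context d (T : measurableType d) (n : nat).

Definition cons_tuple (x : T * n.-tuple T) : n.+1.-tuple T :=
  [tuple of x.1 :: x.2].

Let measurable_cons_tuple : measurable_fun [set: T * n.-tuple T] cons_tuple.
Proof. exact: measurable_cons measurable_fst measurable_snd. Qed.

HB.instance Definition _ :=
  isMeasurableFun.Build _ _ _ _ cons_tuple measurable_cons_tuple.

End cons_tuple.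

(* The law P^n of an i.i.d. sample (X_1, ..., X_n) drawn from P, on the product
   sigma-algebra of T^n: P^0 is the point mass at the empty tuple, and P^(n+1)
   is the law of X_1 :: (X_2, ..., X_(n+1)) under P \x P^n. *)
Fixpoint iid_law d (T : measurableType d) (R : realType) (P : probability T R)
    (n : nat) : probability (n.-tuple T) R :=
  match n with
  | 0 => \d_([tuple] : 0.-tuple T)
  | m.+1 => distribution (P \x iid_law P m)%E (@cons_tuple _ T m)
  end.

Lemma iid_law_box d (T : measurableType d) (R : realType)
    (P : probability T R) (n : nat) (A : 'I_n -> set T) :
  (forall i, measurable (A i)) ->
  iid_law P n [set x | forall i, A i (tnth x i)] = (\prod_(i < n) P (A i))%E.
Proof.
elim: n A => [|n IHn] A mA.
  rewrite big_ord0 /= diracE mem_set//=.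
  by case.
rewrite big_ord_recl -IHn//= /distribution /pushforward.
rewrite -product_measure1E//; last first.
  rewrite (_ : [set _ | _] =
    \bigcap_(i in [set: 'I_n]) ((@tnth n T)^~ i @^-1` A (lift ord0 i))); last first.
    by apply/seteqP; split=> [x /= h i _|x /= h i]; exact: h.
  apply: fin_bigcap_measurable => // i _.
  by rewrite -[X in measurable X]setTI; apply: measurable_tnth.
congr (_ _); apply/seteqP; split => [x /= h|x /= [h0 h] i].
  split; first by have := h ord0; rewrite (tnth_nth x.1).
  by move=> i; have := h (lift ord0 i); rewrite tnthS.
by case: (unliftP ord0 i) => [j ->|->//]; rewrite tnthS.
Qed.

Section hellinger_affinity.
Local Open Scope ereal_scope.
Local Open Scope charge_scope.
Context d (T : measurableType d) (R : realType).

Section sum_measure.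
Variables P Q : probability T R.

Definition sum_measure : set T -> \bar R := measure_add P Q.

HB.instance Definition _ := Measure.on sum_measure.

Let sum_measure_fin : fin_num_fun sum_measure.
Proof.
move=> A mA; rewrite /sum_measure measure_addE fin_numD.
by rewrite !fin_num_measure.
Qed.

HB.instance Definition _ :=
  Measure_isFinite.Build _ _ _ sum_measure sum_measure_fin.

End sum_measure.

Definition hellinger_integral (P Q : probability T R)
    (w : {sigma_finite_measure set T -> \bar R}) : \bar R :=
  \int[w]_x sqrte ('d (charge_of_finite_measure P) '/d w x *
                   'd (charge_of_finite_measure Q) '/d w x).

(* P + Q dominates both P and Q; hellinger_affinityE below shows that any other
   dominating measure gives the same value. *)
Definition hellinger_affinity (P Q : probability T R) : \bar R :=
  hellinger_integral P Q (sum_measure P Q).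

Let dominates_sum_measure (P Q : probability T R) :
  (P `<< sum_measure P Q) /\ (Q `<< sum_measure P Q).
Proof.
split; apply/null_content_dominatesP => A mA; rewrite /= /sum_measure measure_addE.
  by move/eqP; rewrite padde_eq0// => /andP[/eqP + _].
by move/eqP; rewrite padde_eq0// => /andP[_ /eqP].
Qed.

Lemma hellinger_affinityE (P Q : probability T R)
    (w : {sigma_finite_measure set T -> \bar R}) :
  P `<< w -> Q `<< w -> hellinger_affinity P Q = hellinger_integral P Q w.
Proof.
move=> Pw Qw; rewrite /hellinger_affinity.
pose nu : {finite_measure set T -> \bar R} := sum_measure P Q.
rewrite -/nu.
have [Pnu Qnu] := dominates_sum_measure P Q.
have nuw : nu `<< w.
  apply/null_content_dominatesP => A mA wA.
  rewrite /= /nu /sum_measure measure_addE.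
  have /null_content_dominatesP/(_ A mA wA) PA := Pw.
  have /null_content_dominatesP/(_ A mA wA) QA := Qw.
  by rewrite [X in X + _]PA [X in _ + X]QA adde0.
rewrite /hellinger_integral.
set p := 'd (charge_of_finite_measure P) '/d nu.
set q := 'd (charge_of_finite_measure Q) '/d nu.
pose h : T -> \bar R := Radon_Nikodym_SigmaFinite.f nu w.
have h0 x : 0 <= h x by exact: Radon_Nikodym_SigmaFinite.f_ge0.
have mh : measurable_fun setT h.
  exact: measurable_int (Radon_Nikodym_SigmaFinite.f_integrable nuw).
have mp : measurable_fun setT p.
  by apply: measurable_int; apply: Radon_Nikodym_integrable.
have mq : measurable_fun setT q.
  by apply: measurable_int; apply: Radon_Nikodym_integrable.
have msqrt (f g : T -> \bar R) : measurable_fun setT f ->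
    measurable_fun setT g -> (forall x, f x \is a fin_num) ->
    (forall x, g x \is a fin_num) ->
    measurable_fun setT (fun x => sqrte (f x * g x)).
  move=> mf mg ff fg.
  rewrite (_ : (fun _ => _) =
    EFin \o (@Num.sqrt R \o (fine \o (fun x => f x * g x)))); last first.
    apply/funext => x /=; rewrite -{1}(fineK (ff x)) -{1}(fineK (fg x)).
    by rewrite fineM.
  apply/measurable_EFinP; apply: measurableT_comp.
    by apply: continuous_measurable_fun; exact: sqrt_continuous.
  apply: measurableT_comp => //.
  exact: emeasurable_funM.
have pfin x : p x \is a fin_num by exact: Radon_Nikodym_fin_num.
have qfin x : q x \is a fin_num by exact: Radon_Nikodym_fin_num.
have mpq := msqrt _ _ mp mq pfin qfin.
rewrite -(Radon_Nikodym_SigmaFinite.change_of_variables nuw)//; last first.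
  by move=> x; exact: sqrte_ge0.
apply: ge0_ae_eq_integral => //.
- exact: emeasurable_funM.
- apply: msqrt.
  + by apply: measurable_int; apply: Radon_Nikodym_integrable.
  + by apply: measurable_int; apply: Radon_Nikodym_integrable.
  + by move=> x; exact: Radon_Nikodym_fin_num.
  + by move=> x; exact: Radon_Nikodym_fin_num.
- by move=> x _; rewrite mule_ge0// sqrte_ge0.
- by move=> x _; exact: sqrte_ge0.
have hE := ae_eq_Radon_Nikodym_SigmaFinite nuw measurableT.
have pE := @Radon_Nikodym_chain_rule _ _ _ (charge_of_finite_measure P) w nu Pnu nuw.
have qE := @Radon_Nikodym_chain_rule _ _ _ (charge_of_finite_measure Q) w nu Qnu nuw.
apply: filterS3 hE pE qE => x /= hx px qx _.
have {}px := px I; have {}qx := qx I; have {}hx := hx I.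
rewrite px qx -hx -/p -/q -/(h x) muleACA [_ * (h x * _)]muleC.
rewrite [RHS]sqrteM ?mule_ge0// -[h x * h x]expe2 sqrte_sqr gee0_abs//.
by rewrite muleC.
Qed.

End hellinger_affinity.

Section robust_mean_estimation.
Local Open Scope ereal_scope.
Context (R : realType).
Implicit Types (phi : R -> R) (B mu Delta : R).

(* The class C_mu.  Integrability of the identity is what makes the mean
   \int x dP a well-defined real number. *)
Definition mean_class phi B mu : set (probability R R) :=
  [set P : probability R R |
    [/\ P.-integrable [set: R] (fun x => x%:E),
        \int[P]_x x%:E = mu%:E &
        \int[P]_x (phi (x - mu)%R)%:E <= B%:E ] ].

Definition worst_case_confidence phi B (n : nat) (est : n.-tuple R -> R)
    Delta : \bar R :=
  maxe
    (ereal_sup [set y | exists mu (P : probability R R), mean_class phi B mu P /\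
       y = iid_law P n [set x | (mu + Delta < est x)%R] ])
    (ereal_sup [set y | exists mu (P : probability R R), mean_class phi B mu P /\
       y = iid_law P n [set x | (est x < mu - Delta)%R] ]).

Definition hellinger_rate phi B Delta : \bar R :=
  - lne (ereal_sup [set y | exists Pm Pp : probability R R,
      [/\ mean_class phi B (- Delta)%R Pm, mean_class phi B Delta Pp &
          y = hellinger_affinity Pm Pp] ]).

End robust_mean_estimation.

(* Main.v *)
Require Import Defs.
From HB Require Import structures.
From mathcomp Require Import all_boot all_order all_algebra.
From mathcomp Require Import all_classical all_reals all_analysis measurable_realfun.
From mathcomp Require Import ring lra.

(* An estimator tests P_- in C_(-Delta) against P_+ in C_Delta. The testing
   error exponent of a fixed pair is the Chernoff information, which may be
   larger than - log rho(P_-, P_+); but averaging the pair with its reflection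
   (P_+(- .), P_-(- .)) stays in the two classes, does not decrease the affinity
   (Cauchy-Schwarz), and yields a symmetric pair, for which the Chernoff exponent
   is attained at 1/2. There, with densities a and b, the tilted means
   a^((1-s)/2) b^((1+s)/2) integrate to at most rho + s^2, so that the n-fold
   product of sqrt(ab) concentrates where the likelihood ratio is e^(o(n)), and
   the sum of the two errors is at least rho^n e^(-o(n)).

   The two strict error events do not cover est = 0, so the means are first pushed
   apart to -(Delta + h) and Delta + h at a small cost in affinity, the slack
   phi(0) < B paying for the displacement. *)

Set Implicit Arguments.
Unset Strict Implicit.
Unset Printing Implicit Defensive.
Import Order.TTheory GRing.Theory Num.Theory.
Import numFieldNormedType.Exports.

Local Open Scope classical_set_scope.
Local Open Scope ring_scope.

(** * Tilted geometric means *)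

Section geometric_mean.
Context {R : realType}.
Implicit Types a b s : R.

(** For positive [a] and [b] this is sqrt(ab) (b/a)^(s/2), the integrand of the Hellinger transform:
    [s = 0] gives the affinity, and positive [s] tilts towards [b]. *)
Definition geo_mean s a b : R := a `^ ((1 - s) / 2) * b `^ ((1 + s) / 2).

Lemma geo_mean_ge0 s a b : 0 <= geo_mean s a b.
Proof. by rewrite mulr_ge0// powR_ge0. Qed.

Lemma geo_meanC s a b : geo_mean s a b = geo_mean (- s) b a.
Proof. by rewrite /geo_mean opprK mulrC. Qed.

Lemma geo_mean_sqrt a b : 0 <= a -> 0 <= b -> geo_mean 0 a b = Num.sqrt (a * b).
Proof.
move=> a0 b0; rewrite -powR12_sqrt ?mulr_ge0// powRM// /geo_mean.
by rewrite subr0 addr0 mul1r.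
Qed.

Lemma geo_meanM s a b c d : 0 <= a -> 0 <= b -> 0 <= c -> 0 <= d ->
  geo_mean s (a * b) (c * d) = geo_mean s a c * geo_mean s b d.
Proof. by move=> a0 b0 c0 d0; rewrite /geo_mean !powRM// mulrACA. Qed.

Lemma geo_mean_prod s n (f g : 'I_n -> R) :
  (forall i, 0 <= f i) -> (forall i, 0 <= g i) ->
  geo_mean s (\prod_(i < n) f i) (\prod_(i < n) g i) =
  \prod_(i < n) geo_mean s (f i) (g i).
Proof.
move=> f0 g0; elim: n f g f0 g0 => [|n IHn] f g f0 g0.
  by rewrite !big_ord0 /geo_mean !powR1 mulr1.
by rewrite !big_ord_recl geo_meanM ?IHn// prodr_ge0.
Qed.

Lemma geo_mean_expR s a b : 0 < a -> 0 < b ->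
  geo_mean s a b = expR ((ln a + ln b) / 2) * expR (s * ((ln b - ln a) / 2)).
Proof.
move=> a0 b0; rewrite /geo_mean /powR !gt_eqF// -!expRD; congr expR.
by field.
Qed.

(** The strict bounds keep both exponents nonzero, which matters because zero to the power zero is
    1. *)
Lemma geo_mean_eq0 s a b : -1 < s < 1 -> a * b = 0 -> geo_mean s a b = 0.
Proof.
move=> /andP[s1 s2] /eqP; rewrite mulf_eq0 => /orP[] /eqP ->;
  by rewrite /geo_mean powR0 ?mul0r ?mulr0//; lra.
Qed.

(** Halving the argument divides cosh - 1 by at least 4: with S = e^(z/2) + e^(-z/2), one has e^z +
    e^(-z) - 2 = S^2 - 4, and 4 (S - 2) <= S^2 - 4 amounts to (S - 2)^2 >= 0. Dyadic factors turn
    this into an induction. *)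
Lemma expR_sum_dyadic_le (k : nat) (y : R) :
  expR (2^-1 ^+ k * y) + expR (- (2^-1 ^+ k * y)) - 2 <=
  (2^-1 ^+ k) ^+ 2 * (expR y + expR (- y) - 2).
Proof.
elim: k => [|k IHk]; first by rewrite !expr0 expr1n !mul1r.
set z := 2^-1 ^+ k * y in IHk.
have -> : 2^-1 ^+ k.+1 * y = z / 2 by rewrite /z exprS; field.
have -> : (2^-1 ^+ k.+1 : R) ^+ 2 = (2^-1 ^+ k) ^+ 2 / 4.
  by rewrite [2^-1 ^+ k.+1]exprS exprMn; field.
apply: (@le_trans _ _ ((expR z + expR (- z) - 2) / 4)); last by nra.
have zE : z = z / 2 + z / 2 by lra.
rewrite [in leRHS]zE [- (z / 2 + _)]opprD !expRD.
have : expR (z / 2) * expR (- (z / 2)) = 1 by rewrite -expRD subrr expR0.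
have := expR_gt0 (z / 2); have := expR_gt0 (- (z / 2)).
set c := expR _; set c' := expR _ => c0 c'0 cc.
have : 2 <= c + c'.
  rewrite -(@ler_pXn2r _ 2)//; [|by rewrite nnegrE; lra..].
  have := sqr_ge0 (c - c'); nra.
move=> cc'; have : 0 <= (c + c' - 2) * (c + c' - 2) by rewrite mulr_ge0//; lra.
nra.
Qed.

(** Let e = 2^-k, and let [m] and [y] be the half sum and half difference of the logarithms. The
    left side is 2 e^m cosh(ey), while a + b = 2 e^m cosh(y). Adding opposite tilts cancels the
    first-order term, so the excess is of order e^2. *)
Lemma geo_mean_tilt (k : nat) a b : 0 <= a -> 0 <= b -> (0 < k)%N ->
  geo_mean (2^-1 ^+ k) a b + geo_mean (- 2^-1 ^+ k) a b <=
  2 * geo_mean 0 a b + (2^-1 ^+ k) ^+ 2 * (a + b).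
Proof.
move=> a0 b0 k0.
have e1 : (2^-1 : R) ^+ k < 1 by rewrite exprn_ilt1 ?lt0n_neq0//; lra.
have e0 : 0 < (2^-1 : R) ^+ k by rewrite exprn_gt0.
(* A vanishing argument, which has no usable logarithm, makes all three geometric means zero. *)
have [ab0|ab0] := eqVneq (a * b) 0.
  rewrite !geo_mean_eq0//; [|lra..].
  by rewrite mulr0 !add0r mulr_ge0 ?sqr_ge0// addr_ge0.
have {}a0 : 0 < a.
  by rewrite lt_neqAle a0 andbT eq_sym; apply: contra_neq ab0 => ->; rewrite mul0r.
have {}b0 : 0 < b.
  by rewrite lt_neqAle b0 andbT eq_sym; apply: contra_neq ab0 => ->; rewrite mulr0.
rewrite !geo_mean_expR// mulNr mul0r expR0 mulr1.
set m := (ln a + ln b) / 2; set y := (ln b - ln a) / 2.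
have aE : a = expR m * expR (- y).
  by rewrite -expRD -[LHS]lnK ?posrE//; congr expR; rewrite /m /y; field.
have bE : b = expR m * expR y.
  by rewrite -expRD -[LHS]lnK ?posrE//; congr expR; rewrite /m /y; field.
rewrite [in leRHS]aE [in leRHS]bE.
have := expR_sum_dyadic_le k y; have := expR_gt0 m; have := sqr_ge0 ((2^-1 : R) ^+ k).
set E := _ ^+ 2; set M := expR m; set X := expR _; set Y := expR _.
set Z := expR _; set W := expR _ => E0 M0 H.
have : M * (X + Y - 2) <= M * (E * (Z + W - 2)) by rewrite ler_pM2l.
nra.
Qed.

(* On [a <= b], [geo_mean 0 a b = expR (|ln (b / a)| / 2) * a]; the tilted means
   take over as soon as [|ln (b / a)| / 2 > D]. *)
Lemma geo_mean_le_min s a b D : 0 <= a -> 0 <= b -> 0 < s < 1 -> 0 <= D ->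
  geo_mean 0 a b <= expR D * Num.min a b +
    expR (- (s * D)) * (geo_mean s a b + geo_mean (- s) a b).
Proof.
move=> a0 b0 /andP[s0 s1] D0.
wlog ab : a b a0 b0 / a <= b.
  move=> H; have /orP[ab|ba] := le_total a b; first exact: H.
  have := H _ _ b0 a0 ba; rewrite (geo_meanC 0 b) (geo_meanC s b) (geo_meanC (- s) b).
  by rewrite oppr0 opprK minC [geo_mean (- s) _ _ + _]addrC.
have [ab0|ab0] := eqVneq (a * b) 0.
  rewrite !geo_mean_eq0//; [|lra..].
  by rewrite addr0 mulr0 addr0 mulr_ge0 ?expR_ge0// le_min a0.
have {}a0 : 0 < a.
  by rewrite lt_neqAle a0 andbT eq_sym; apply: contra_neq ab0 => ->; rewrite mul0r.
have {}b0 : 0 < b by exact: lt_le_trans ab.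
rewrite (min_idPl ab) !geo_mean_expR// mulNr mul0r expR0 mulr1.
set m := (ln a + ln b) / 2; set y := (ln b - ln a) / 2.
have y0 : 0 <= y by rewrite divr_ge0// subr_ge0 ler_ln.
have aE : a = expR m * expR (- y).
  by rewrite -expRD -[LHS]lnK ?posrE//; congr expR; rewrite /m /y; field.
have M0 := expR_gt0 m.
(* If [y <= D], then e^m = e^y a <= e^D a and the first term suffices; otherwise the upward tilt e^m
   e^(sy) is at least e^m e^(sD). *)
have [yD|/ltW Dy] := leP y D.
  apply: ler_wpDr; first by rewrite !(mulr_ge0, addr_ge0, expR_ge0).
  rewrite aE mulrCA ler_peMr ?expR_ge0// -expRD.
  by rewrite -expR0 ler_expR subr_ge0.
rewrite ler_wpDl ?mulr_ge0 ?expR_ge0 ?(ltW a0)//.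
rewrite mulrDr ler_wpDr ?mulr_ge0 ?expR_ge0//.
rewrite mulrCA ler_peMr ?expR_ge0// -expRD -expR0 ler_expR.
by rewrite addrC subr_ge0 ler_wpM2l// ltW.
Qed.

End geometric_mean.

(** * Product measures and sub-densities *)

Section iid_law_integral.
Local Open Scope ereal_scope.
Context d (T : measurableType d) (R : realType).
Implicit Types (P w : probability T R).

Lemma ge0_integral_iid_lawS P n (H : n.+1.-tuple T -> \bar R) :
  measurable_fun setT H -> (forall x, 0 <= H x) ->
  \int[iid_law P n.+1]_x H x =
  \int[P]_x \int[iid_law P n]_y H (Defs.cons_tuple (x, y)).
Proof.
move=> mH H0.
rewrite /iid_law -/(iid_law P n) ge0_integral_distribution//.
rewrite fubini_tonelli1//; last by move=> x; exact: H0.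
exact: measurableT_comp.
Qed.

Lemma measurable_prod_tnth n (g : T -> R) : measurable_fun setT g ->
  measurable_fun setT (fun x : n.-tuple T => \prod_(i < n) g (tnth x i))%R.
Proof.
move=> mg; apply: measurable_prod => i _.
by apply: measurableT_comp => //; exact: measurable_tnth.
Qed.

Lemma prod_cons_tuple n (g : T -> R) (x : T) (y : n.-tuple T) :
  (\prod_(i < n.+1) g (tnth (Defs.cons_tuple (x, y)) i) =
   g x * \prod_(i < n) g (tnth y i))%R.
Proof.
rewrite big_ord_recl; congr (_ * _)%R; apply: eq_bigr => i _.
by rewrite tnthS.
Qed.

Lemma integral_iid_law_prod w n (g : T -> R) :
  measurable_fun setT g -> (forall x, (0 <= g x)%R) ->
  \int[iid_law w n]_x (\prod_(i < n) g (tnth x i))%:E =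
  (\int[w]_x (g x)%:E) ^+ n.
Proof.
move=> mg g0; elim: n => [|n IHn].
  under eq_integral do rewrite big_ord0.
  by rewrite (integral_cst (iid_law w 0))// mul1e; exact: probability_setT.
rewrite ge0_integral_iid_lawS; last 2 first.
- by apply/measurable_EFinP; exact: measurable_prod_tnth.
- by move=> x; rewrite lee_fin prodr_ge0.
under eq_integral => x _.
  under eq_integral => y _ do rewrite prod_cons_tuple EFinM.
  rewrite ge0_integralZl ?lee_fin//; last 2 first.
  - by apply/measurable_EFinP; exact: measurable_prod_tnth.
  - by move=> y _; rewrite lee_fin prodr_ge0.
  rewrite IHn; over.
rewrite ge0_integralZr//; last 3 first.
- exact/measurable_EFinP.
- by move=> x _; rewrite lee_fin.
- by rewrite expe_ge0// integral_ge0// => x _; rewrite lee_fin.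
by rewrite expeS.
Qed.

Definition subdensity w P (a : T -> R) := [/\ measurable_fun setT a,
  forall x, (0 <= a x)%R &
  forall h : T -> \bar R, measurable_fun setT h -> (forall x, 0 <= h x) ->
    \int[w]_x ((a x)%:E * h x) <= \int[P]_x h x].

Lemma subdensity_iid_law w P (a : T -> R) n (H : n.-tuple T -> \bar R) :
  subdensity w P a -> measurable_fun setT H -> (forall x, 0 <= H x) ->
  \int[iid_law w n]_x ((\prod_(i < n) a (tnth x i))%:E * H x) <=
  \int[iid_law P n]_x H x.
Proof.
move=> [ma a0 aP]; elim: n H => [|n IHn] H mH H0.
  by under eq_integral do rewrite big_ord0 mul1e.
have mHx x : measurable_fun setT (fun y => H (Defs.cons_tuple (x, y))).
  by apply: measurableT_comp => //; apply: measurableT_comp.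
have mHc : measurable_fun setT (fun z : T * n.-tuple T => H (Defs.cons_tuple z)).
  exact: measurableT_comp.
rewrite !ge0_integral_iid_lawS//; last 2 first.
- by apply: emeasurable_funM => //; apply/measurable_EFinP; exact: measurable_prod_tnth.
- by move=> x; rewrite mule_ge0// lee_fin prodr_ge0.
(* In the intermediate integral all coordinates but the first have been moved from [w] to [P]; the
   induction hypothesis gives one inequality and the subdensity property the other. *)
apply: (@le_trans _ _
    (\int[w]_x ((a x)%:E * \int[iid_law P n]_y H (Defs.cons_tuple (x, y))))); last first.
  apply: aP; last by move=> x; exact: integral_ge0.
  exact: (@measurable_fun_fubini_tonelli_F _ _ _ _ _ (iid_law P n) _ mHc (fun=> H0 _)).
under eq_integral => x _.
  under eq_integral => y _ do rewrite prod_cons_tuple EFinM -muleA.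
  rewrite ge0_integralZl ?lee_fin//; last 2 first.
  - by apply: emeasurable_funM => //; apply/measurable_EFinP; exact: measurable_prod_tnth.
  - by move=> y _; rewrite mule_ge0// lee_fin prodr_ge0.
  over.
apply: ge0_le_integral => //.
- move=> x _; rewrite mule_ge0 ?lee_fin//; apply: integral_ge0 => y _.
  by rewrite mule_ge0// lee_fin prodr_ge0.
- apply: emeasurable_funM; first exact/measurable_EFinP.
  apply: (@measurable_fun_fubini_tonelli_F _ _ _ _ _ (iid_law w n)
    (fun z => (\prod_(i < n) a (tnth z.2 i))%:E * H (Defs.cons_tuple z))) => /=.
    apply: emeasurable_funM => //; apply/measurable_EFinP.
    exact: (measurableT_comp (measurable_prod_tnth ma)).
  by move=> z; rewrite mule_ge0// lee_fin prodr_ge0.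
- apply: emeasurable_funM; first exact/measurable_EFinP.
  exact: (@measurable_fun_fubini_tonelli_F _ _ _ _ _ (iid_law P n) _ mHc (fun=> H0 _)).
- by move=> x _; rewrite lee_wpmul2l ?lee_fin// IHn.
Qed.

End iid_law_integral.

(** * Testing a symmetric pair *)

Section symmetric_testing.
Local Open Scope ereal_scope.
Context d (T : measurableType d) (R : realType).
Implicit Types (P Q w : probability T R).

Lemma measurable_geo_mean d' (S : measurableType d') (s : R) (f g : S -> R) :
  measurable_fun setT f -> measurable_fun setT g ->
  measurable_fun setT (fun x => geo_mean s (f x) (g x)).
Proof.
move=> mf mg; apply: measurable_funM.
  exact: (measurableT_comp (measurable_powR _)).
exact: (measurableT_comp (measurable_powR _)).
Qed.

Lemma ge0_integral_affine2 d' (S : measurableType d')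
    (m : {measure set S -> \bar R}) (k l : R) (f g : S -> R) :
  measurable_fun setT f -> measurable_fun setT g ->
  (forall x, (0 <= f x)%R) -> (forall x, (0 <= g x)%R) ->
  (0 <= k)%R -> (0 <= l)%R ->
  \int[m]_x (k * f x + l * g x)%:E =
  k%:E * \int[m]_x (f x)%:E + l%:E * \int[m]_x (g x)%:E.
Proof.
move=> mf mg f0 g0 k0 l0.
under eq_integral do rewrite EFinD !EFinM.
rewrite ge0_integralD//; last 4 first.
- by move=> x _; rewrite mule_ge0 ?lee_fin.
- by apply: emeasurable_funM => //; exact/measurable_EFinP.
- by move=> x _; rewrite mule_ge0 ?lee_fin.
- by apply: emeasurable_funM => //; exact/measurable_EFinP.
rewrite !ge0_integralZl ?lee_fin//.
- exact/measurable_EFinP.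
- by move=> x _; rewrite lee_fin.
- exact/measurable_EFinP.
- by move=> x _; rewrite lee_fin.
Qed.

Lemma subdensity_le1 w P (a : T -> R) :
  subdensity w P a -> \int[w]_x (a x)%:E <= 1.
Proof.
move=> [ma a0 aP].
have := aP (cst 1) (@measurable_cst _ _ _ _ _ _) (fun=> lee01).
rewrite (integral_cst P)// mul1e [X in _ <= X -> _]probability_setT.
by under eq_integral do rewrite /= mule1.
Qed.

(** The easy half of the Neyman-Pearson lemma: the minimum is at most the first product on [A] and
    at most the second one off [A]. *)
Lemma integral_min_le w P Q (a b : T -> R) n (A : set (n.-tuple T)) :
  subdensity w P a -> subdensity w Q b -> measurable A ->
  \int[iid_law w n]_x
    (Num.min (\prod_(i < n) a (tnth x i)) (\prod_(i < n) b (tnth x i)))%:E <=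
  iid_law P n A + iid_law Q n (~` A).
Proof.
move=> sa sb mA; have [ma a0 _] := sa; have [mb b0 _] := sb.
have mAc : measurable (~` A) by exact: measurableC.
have indE (B : set (n.-tuple T)) (mB : measurable B) (m : probability (n.-tuple T) R) :
    m B = \int[m]_x (\1_B x)%:E by rewrite integral_indic// setIT.
have mI (B : set (n.-tuple T)) : measurable B ->
    measurable_fun setT (fun x => (\1_B x)%:E : \bar R).
  by move=> mB; apply/measurable_EFinP; exact: measurable_indic.
have I0 (B : set (n.-tuple T)) x : (0 : \bar R) <= (\1_B x)%:E by rewrite lee_fin.
rewrite (indE A)// (indE (~` A))//.
apply: le_trans (leeD (subdensity_iid_law sa (mI _ mA) (I0 _))
  (subdensity_iid_law sb (mI _ mAc) (I0 _))).
have mpa : measurable_fun setT (fun x : n.-tuple T =>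
    (\prod_(i < n) a (tnth x i))%:E * (\1_A x)%:E).
  apply: emeasurable_funM; last exact: mI.
  by apply/measurable_EFinP; exact: measurable_prod_tnth.
have mpb : measurable_fun setT (fun x : n.-tuple T =>
    (\prod_(i < n) b (tnth x i))%:E * (\1_(~` A) x)%:E).
  apply: emeasurable_funM; last exact: mI.
  by apply/measurable_EFinP; exact: measurable_prod_tnth.
rewrite -ge0_integralD//; last 2 first.
- by move=> x _; rewrite mule_ge0// lee_fin prodr_ge0.
- by move=> x _; rewrite mule_ge0// lee_fin prodr_ge0.
apply: ge0_le_integral => //.
- by move=> x _; rewrite lee_fin le_min !prodr_ge0.
- apply/measurable_EFinP; apply: measurable_minr; exact: measurable_prod_tnth.
- exact: emeasurable_funD.
- move=> x _; rewrite -!EFinM -EFinD lee_fin !indicE in_setC.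
  case: (x \in A) => /=.
    by rewrite mulr1 mulr0 addr0 ge_min lexx.
  by rewrite mulr1 mulr0 add0r ge_min lexx orbT.
Qed.

Lemma integral_geo_mean_prod w (a b : T -> R) s n :
  measurable_fun setT a -> measurable_fun setT b ->
  (forall x, (0 <= a x)%R) -> (forall x, (0 <= b x)%R) ->
  \int[iid_law w n]_x
    (geo_mean s (\prod_(i < n) a (tnth x i)) (\prod_(i < n) b (tnth x i)))%:E =
  (\int[w]_x (geo_mean s (a x) (b x))%:E) ^+ n.
Proof.
move=> ma mb a0 b0.
rewrite -integral_iid_law_prod//; last 2 first.
- exact: measurable_geo_mean.
- by move=> x; exact: geo_mean_ge0.
by apply: eq_integral => x _; rewrite geo_mean_prod.
Qed.

Section lower_bound.
Variables (w P Q : probability T R) (a b : T -> R) (rho : R).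
Hypotheses (aP : subdensity w P a) (bQ : subdensity w Q b).
Hypothesis geo_sym : forall s : R,
  \int[w]_x (geo_mean s (a x) (b x))%:E =
  \int[w]_x (geo_mean (- s) (a x) (b x))%:E.
Hypothesis rhoE : \int[w]_x (geo_mean 0 (a x) (b x))%:E = rho%:E.

(** By [geo_sym] the integral of one tilt is half that of the two opposite tilts together, to which
    [geo_mean_tilt] applies; the masses of [a] and [b] are at most 1. This is where symmetry places
    the Chernoff exponent at 1/2: there is no term linear in the tilt. *)
Lemma integral_geo_mean_tilt k : (0 < k)%N ->
  \int[w]_x (geo_mean (2^-1 ^+ k) (a x) (b x))%:E <=
  (rho + (2^-1 ^+ k) ^+ 2)%:E.
Proof.
move=> k0; have [ma a0 _] := aP; have [mb b0 _] := bQ.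
set e : R := (2^-1 ^+ k)%R.
have mg s : measurable_fun setT (fun x => geo_mean s (a x) (b x)).
  exact: measurable_geo_mean.
have g0 s x : (0 <= geo_mean s (a x) (b x))%R by exact: geo_mean_ge0.
suff: 2%:E * \int[w]_x (geo_mean e (a x) (b x))%:E <=
      2%:E * (rho + e ^+ 2)%:E by rewrite lee_pmul2l.
have -> : 2%:E * \int[w]_x (geo_mean e (a x) (b x))%:E =
    \int[w]_x (1 * geo_mean e (a x) (b x) + 1 * geo_mean (- e) (a x) (b x))%:E.
  by rewrite ge0_integral_affine2// -(geo_sym e) !mul1e -mule2n mule_natl.
apply: (@le_trans _ _
    (\int[w]_x (2 * geo_mean 0 (a x) (b x) + e ^+ 2 * (a x + b x))%:E)).
  apply: ge0_le_integral => //.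
  - by move=> x _; rewrite lee_fin !mul1r addr_ge0.
  - by apply/measurable_EFinP; apply: measurable_funD; exact: measurable_funM.
  - apply/measurable_EFinP; apply: measurable_funD; apply: measurable_funM => //.
    exact: measurable_funD.
  - by move=> x _; rewrite lee_fin !mul1r geo_mean_tilt.
rewrite ge0_integral_affine2 ?sqr_ge0//; last 2 first.
- exact: measurable_funD.
- by move=> x; rewrite addr_ge0.
rewrite rhoE.
have : \int[w]_x (a x + b x)%:E <= 2%:E.
  under eq_integral => x _ do rewrite -[a x]mul1r -[b x]mul1r.
  rewrite ge0_integral_affine2// !mul1e.
  have -> : 2%:E = (1 + 1 : \bar R) by rewrite -EFinD.
  by rewrite leeD// (subdensity_le1 aP, subdensity_le1 bQ).
move=> H.
have -> : 2%:E * (rho + e ^+ 2)%:E = 2%:E * rho%:E + (e ^+ 2)%:E * 2%:E.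
  by rewrite -!EFinM -EFinD; congr EFin; ring.
by rewrite leeD// lee_wpmul2l// lee_fin sqr_ge0.
Qed.

(** Integrate [geo_mean_le_min] for the product densities with threshold D = n delta. With X the sum
    of the two errors, rho^n <= e^D X + 2 theta^n rho^n for some theta < 1, and the last term is
    eventually at most rho^n / 2, uniformly in [A]. *)
Lemma testing_lower_bound (delta : R) : (0 < delta)%R -> (0 < rho)%R ->
  \forall n \near \oo, forall A : set (n.-tuple T), measurable A ->
    (2^-1 * (expR (- (n%:R * delta)) * rho ^+ n))%:E <=
    iid_law P n A + iid_law Q n (~` A).
Proof.
move=> d0 rho0; have [ma a0 _] := aP; have [mb b0 _] := bQ.
(* The bound e < rho delta yields 1 + e^2 / rho < 1 + e delta <= e^(e delta), hence [theta < 1]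
   below. *)
have [k k0 ke] : exists2 k, (0 < k)%N & (2^-1 ^+ k < rho * delta :> R)%R.
  have : (2^-1 ^+ k)%R @[k --> \oo] --> (0 : R)%R.
    by apply: cvg_expr; rewrite ger0_norm//; lra.
  move=> /cvgrPdist_lt/(_ (rho * delta)%R); rewrite mulr_gt0// => /(_ isT)[N _ HN].
  exists (maxn N 1); first by rewrite leq_max orbT.
  have := HN (maxn N 1); rewrite /= leq_maxl => /(_ isT).
  by rewrite sub0r normrN ger0_norm// exprn_ge0.
set e : R := (2^-1 ^+ k)%R in ke.
have e0 : (0 < e)%R by rewrite exprn_gt0.
have e1 : (e < 1)%R by rewrite exprn_ilt1 ?lt0n_neq0//; lra.
pose theta := (expR (- (e * delta)) * (1 + e ^+ 2 / rho))%R.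
have theta0 : (0 < theta)%R.
  by rewrite mulr_gt0 ?expR_gt0// addr_gt0// divr_gt0// exprn_gt0.
have theta1 : (theta < 1)%R.
  rewrite /theta expRN mulrC ltr_pdivrMr ?expR_gt0// mul1r.
  apply: lt_le_trans (expR_ge1Dx _); rewrite ltrD2l ltr_pdivrMr// expr2 -mulrA.
  by rewrite ltr_pM2l// mulrC.
have : (theta ^+ n)%R @[n --> \oo] --> (0 : R)%R.
  by apply: cvg_expr; rewrite ger0_norm// ltW.
(* Once theta^n < 1/4, the remainder 2 theta^n rho^n takes at most half of rho^n; this is the factor
   [2^-1] of the conclusion. *)
move=> /cvgrPdist_lt/(_ 4^-1%R); rewrite invr_gt0 ltr0n => /(_ isT).
apply: filterS => n; rewrite sub0r normrN ger0_norm ?exprn_ge0 ?(ltW theta0)// => thn.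
move=> A mA; set X := iid_law P n A + _.
have Xfin : X \is a fin_num by rewrite fin_numD !fin_num_measure//; exact: measurableC.
pose D := (n%:R * delta)%R.
have D0 : (0 <= D)%R by rewrite mulr_ge0// ltW.
pose pa (x : n.-tuple T) := (\prod_(i < n) a (tnth x i))%R.
pose pb (x : n.-tuple T) := (\prod_(i < n) b (tnth x i))%R.
have mpa : measurable_fun setT pa by exact: measurable_prod_tnth.
have mpb : measurable_fun setT pb by exact: measurable_prod_tnth.
have pa0 x : (0 <= pa x)%R by exact: prodr_ge0.
have pb0 x : (0 <= pb x)%R by exact: prodr_ge0.
have mg s : measurable_fun setT (fun x => geo_mean s (pa x) (pb x)).
  exact: measurable_geo_mean.
have mmin : measurable_fun setT (fun x => Num.min (pa x) (pb x)).
  exact: measurable_minr.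
have g0 s x : (0 <= geo_mean s (pa x) (pb x))%R by exact: geo_mean_ge0.
have min0 x : (0 <= Num.min (pa x) (pb x))%R by rewrite le_min pa0 pb0.
have step : (rho ^+ n)%:E <=
    (expR D)%:E * X + (expR (- (e * D)))%:E * (2 * (rho + e ^+ 2) ^+ n)%:E.
  rewrite EFin_expe -rhoE -(integral_geo_mean_prod w 0 n)//.
  apply: (@le_trans _ _ (\int[iid_law w n]_x (expR D * Num.min (pa x) (pb x) +
      expR (- (e * D)) * (1 * geo_mean e (pa x) (pb x) +
        1 * geo_mean (- e) (pa x) (pb x)))%:E)).
    apply: ge0_le_integral => //.
    - by move=> x _; rewrite lee_fin; exact: g0.
    - by apply/measurable_EFinP; exact: (mg 0%R).
    - apply/measurable_EFinP; apply: measurable_funD; apply: measurable_funM => //.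
      by apply: measurable_funD; exact: measurable_funM.
    - move=> x _; rewrite lee_fin !mul1r.
      by apply: (geo_mean_le_min (pa0 x) (pb0 x) _ D0); rewrite e0.
  rewrite ge0_integral_affine2 ?expR_ge0//; last 2 first.
  - by apply: measurable_funD; exact: measurable_funM.
  - by move=> x; rewrite !mul1r addr_ge0.
  apply: leeD.
    by rewrite lee_wpmul2l ?lee_fin ?expR_ge0//; exact: integral_min_le.
  rewrite lee_wpmul2l ?lee_fin ?expR_ge0// ge0_integral_affine2// !mul1e.
  rewrite !integral_geo_mean_prod// -(geo_sym e) -mule2n -mule_natl EFinM.
  rewrite lee_wpmul2l//.
  have := integral_geo_mean_tilt k0; rewrite -/e; set G := integral _ _ _ => Ge.
  have G0 : 0 <= G by apply: integral_ge0 => x _; rewrite lee_fin geo_mean_ge0.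
  have Gfin : G \is a fin_num by rewrite ge0_fin_numE// (le_lt_trans Ge)// ltry.
  move: G0 Ge; rewrite -(fineK Gfin) -EFin_expe !lee_fin => G0 Ge.
  by rewrite lerXn2r ?nnegrE// addr_ge0 ?sqr_ge0// ltW.
rewrite -(fineK Xfin) lee_fin.
move: step; rewrite -(fineK Xfin) -!EFinM -EFinD lee_fin.
have -> : (expR (- (e * D)) * (2 * (rho + e ^+ 2) ^+ n) =
           2 * theta ^+ n * rho ^+ n)%R.
  have -> : expR (- (e * D)) = (expR (- (e * delta)) ^+ n)%R.
    by rewrite -expRM_natl; congr expR; rewrite /D; ring.
  rewrite mulrCA -exprMn -mulrA -exprMn; congr (_ * _ ^+ _)%R.
  by rewrite /theta; field; rewrite gt_eqF.
move=> step; rewrite mulrCA -/D expRN ler_pdivrMl ?expR_gt0//.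
have : (theta ^+ n * rho ^+ n <= 4^-1 * rho ^+ n)%R.
  by rewrite ler_wpM2r ?exprn_ge0 ?(ltW rho0)// ltW.
lra.
Qed.

End lower_bound.
End symmetric_testing.

(** * Mixtures, images and truncations *)

Section mixture.
Local Open Scope ereal_scope.
Context d (T : measurableType d) (R : realType).
Variables (t : R) (t0 : (0 <= t)%R) (t1 : (t <= 1)%R) (P Q : probability T R).

Let t1' : (0 <= 1 - t)%R. Proof. by rewrite subr_ge0. Qed.

Definition mixture : set T -> \bar R :=
  measure_add (mscale (NngNum t0) P) (mscale (NngNum t1') Q).

HB.instance Definition _ := Measure.on mixture.

Let mixture_setT : mixture setT = 1%:E.
Proof.
rewrite /mixture measure_addE /mscale [X in _ * X + _]probability_setT.
rewrite [X in _ + _ * X]probability_setT !mule1 -EFinD.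
by rewrite addrC subrK.
Qed.

HB.instance Definition _ :=
  Measure_isProbability.Build _ _ _ mixture mixture_setT.

Lemma ge0_integral_mixture (f : T -> \bar R) :
  measurable_fun setT f -> (forall x, 0 <= f x) ->
  \int[mixture]_x f x = t%:E * \int[P]_x f x + (1 - t)%:E * \int[Q]_x f x.
Proof.
by move=> mf f0; rewrite ge0_integral_measure_add// !ge0_integral_mscale.
Qed.

Lemma integrable_mixture (f : T -> \bar R) :
  P.-integrable setT f -> Q.-integrable setT f ->
  (mixture : {measure set T -> \bar R}).-integrable setT f.
Proof.
move=> /integrableP[mf Pf] /integrableP[_ Qf]; apply/integrableP; split => //.
rewrite ge0_integral_mixture//; last exact: measurableT_comp.
by rewrite lte_add_pinfty// lte_mul_pinfty ?lee_fin.
Qed.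

Lemma integral_mixture (f : T -> \bar R) :
  P.-integrable setT f -> Q.-integrable setT f ->
  \int[mixture]_x f x = t%:E * \int[P]_x f x + (1 - t)%:E * \int[Q]_x f x.
Proof.
move=> Pf Qf; have mf := measurable_int _ Pf.
rewrite integralE !ge0_integral_mixture//; last 2 first.
- exact: measurable_funeneg.
- exact: measurable_funepos.
rewrite [in RHS]integralE [X in _ = _ + _ * X]integralE.
rewrite -(fineK (integrable_pos_fin_num measurableT Pf)).
rewrite -(fineK (integrable_neg_fin_num measurableT Pf)).
rewrite -(fineK (integrable_pos_fin_num measurableT Qf)).
rewrite -(fineK (integrable_neg_fin_num measurableT Qf)).
by rewrite -!(EFinM, EFinD, EFinB); congr EFin; ring.
Qed.

End mixture.

Section law_of.
Local Open Scope ereal_scope.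
Context d d' (T : measurableType d) (S : measurableType d') (R : realType).
Variables (f : T -> S) (mf : measurable_fun setT f) (P : probability T R).

Let mfun_f : {mfun T >-> S} :=
  MeasurableFun.Pack (MeasurableFun.Class (isMeasurableFun.Build _ _ _ _ f mf)).

Definition law_of : probability S R := distribution P mfun_f.

Lemma ge0_integral_law_of (g : S -> \bar R) :
  measurable_fun setT g -> (forall x, 0 <= g x) ->
  \int[law_of]_y g y = \int[P]_x g (f x).
Proof. exact: ge0_integral_distribution. Qed.

Lemma integrable_law_of (g : S -> \bar R) :
  measurable_fun setT g -> P.-integrable setT (g \o f) ->
  law_of.-integrable setT g.
Proof. by move=> mg gf; apply: integrable_pushforward. Qed.

Lemma integral_law_of (g : S -> \bar R) :
  measurable_fun setT g -> P.-integrable setT (g \o f) ->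
  \int[law_of]_y g y = \int[P]_x g (f x).
Proof. exact: (@integral_distribution _ _ _ _ _ P mfun_f). Qed.

End law_of.

Section truncation.
Local Open Scope ereal_scope.
Context (R : realType).
Implicit Types (P : probability R R) (M m t : R) (F : R -> R).

(** The tail is sent to a free point [m], not to the ends of the window: moving [m] is what adjusts
    the mean. *)
Definition clip M m (x : R) : R := if (`|x| <= M)%R then x else m.

Definition window M : set R := [set x | (`|x| <= M)%R].

Lemma measurable_window M : measurable (window M).
Proof.
rewrite (_ : window M = `[(- M)%R, M]%classic); first exact: measurable_itv.
by apply/seteqP; split => x; rewrite /window /= in_itv /= ler_norml.
Qed.
Hint Resolve measurable_window : core.

Lemma measurable_clip M m : measurable_fun setT (clip M m).
Proof.
apply: measurable_fun_ifT => //.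
apply: measurable_fun_ler => //; exact: measurable_normr.
Qed.

Lemma integrable_window P M F K : measurable_fun setT F ->
  (forall x, window M x -> (`|F x| <= K)%R) -> P.-integrable (window M) (EFin \o F).
Proof.
move=> mF FK; apply: measurable_bounded_integrable => //.
- by rewrite (le_lt_trans (probability_le1 P (measurable_window M)))// ltry.
- exact: measurable_funTS.
- exists K; split; first exact: num_real.
  by move=> r Kr x /FK /le_trans; apply; exact: ltW.
Qed.

Lemma integrable_clip P M m F K : measurable_fun setT F ->
  (forall x, window M x -> (`|F x| <= K)%R) ->
  P.-integrable setT (EFin \o F \o clip M m).
Proof.
move=> mF FK; apply: (measurable_bounded_integrable (f := F \o clip M m)) => //.
- by rewrite (le_lt_trans (probability_le1 P measurableT))// ltry.
- by apply: measurableT_comp => //; exact: measurable_clip.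
- exists (Num.max K `|F m|%R); split; first exact: num_real.
  move=> r Kr x _ /=; apply: le_trans (ltW Kr); rewrite le_max /clip.
  by case: ifPn => [/FK ->//|_]; rewrite lexx orbT.
Qed.

Lemma integral_clip P M m F K : measurable_fun setT F ->
  (forall x, window M x -> (`|F x| <= K)%R) ->
  \int[P]_x (F (clip M m x))%:E =
  \int[P]_(x in window M) (F x)%:E + (F m)%:E * P (~` window M).
Proof.
move=> mF FK.
have mc : measurable_fun setT (fun x => (F (clip M m x))%:E).
  by apply/measurable_EFinP; apply: measurableT_comp => //; exact: measurable_clip.
rewrite -(setUv (window M)) integral_setU//=; last 3 first.
- exact: measurableC.
- by rewrite setUv.
- exact/disj_setPCl.
congr (_ + _).
  by apply: eq_integral => x; rewrite inE /clip /window /= => ->.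
rewrite -integral_cst//; last exact: measurableC.
by apply: eq_integral => x; rewrite inE /clip /window /= => /negP/negbTE ->.
Qed.

Lemma cvg_integral_window P F : P.-integrable setT (EFin \o F) ->
  \int[P]_(x in window n%:R) (F x)%:E @[n --> \oo] --> \int[P]_x (F x)%:E.
Proof.
move=> iF; have mF := measurable_int _ iF.
under eq_fun do rewrite integral_mkcond.
have := (@dominated_convergence _ _ _ P setT measurableT
  (fun n => (EFin \o F) \_ (window n%:R)) (EFin \o F) (fun x => `|(F x)%:E|)
  _ mF _ _ _) => -[]//.
- move=> n; apply/(measurable_restrictT _ (measurable_window _)).
  exact: measurable_funTS.
- apply: aeW => x _; apply: cvg_near_cst.
  near=> n; rewrite patchE mem_set//= /window /=.
  by near: n; exact: nbhs_infty_ger.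
- exact: integrable_abse.
- apply: aeW => x n _; rewrite patchE; case: ifP => // _.
  by rewrite abse0 abse_ge0.
Unshelve. all: by end_near. Qed.

End truncation.

(** * The classes C_mu *)

Section mean_class_theory.
Local Open Scope ereal_scope.
Context (R : realType) (phi : R -> R) (B : R).
Hypotheses (phi_ge0 : forall x, (0 <= phi x)%R)
  (phi_even : forall x, phi (- x)%R = phi x) (phi_cont : continuous phi)
  (phi_ndecr : forall x y : R, (0 <= x)%R -> (x <= y)%R -> (phi x <= phi y)%R)
  (phi0_ltB : (phi 0%R < B)%R).
Implicit Types (P Q : probability R R) (mu t : R).

Let measurable_phiB mu : measurable_fun [set: R] (fun x => phi (x - mu)%R).
Proof.
apply: measurableT_comp; first exact: continuous_measurable_fun.
exact: measurable_funB.
Qed.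

Let phi_le (x y : R) : (`|x| <= y)%R -> (phi x <= phi y)%R.
Proof.
move=> xy; suff -> : phi x = phi `|x|%R by rewrite phi_ndecr.
by have [x0|x0] := ger0P x; rewrite ?phi_even.
Qed.

Lemma mean_class_mixture mu t (t0 : (0 <= t)%R) (t1 : (t <= 1)%R) P Q :
  mean_class phi B mu P -> mean_class phi B mu Q ->
  mean_class phi B mu (mixture t0 t1 P Q).
Proof.
move=> [iP mP bP] [iQ mQ bQ]; split.
- exact: integrable_mixture.
- by rewrite integral_mixture// mP mQ -!EFinM -EFinD; congr EFin; ring.
- rewrite ge0_integral_mixture//; last 2 first.
  + exact/measurable_EFinP.
  + by move=> x; rewrite lee_fin.
  apply: (@le_trans _ _ (t%:E * B%:E + (1 - t)%:E * B%:E)).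
    by rewrite leeD// lee_wpmul2l// lee_fin subr_ge0.
  by rewrite -!EFinM -EFinD lee_fin -mulrDl addrC subrK mul1r.
Qed.

Definition reflection P : probability R R :=
  law_of (@oppr_measurable R setT) P.

Lemma ge0_integral_reflection P (f : R -> \bar R) :
  measurable_fun setT f -> (forall x, 0 <= f x) ->
  \int[reflection P]_x f x = \int[P]_x f (- x)%R.
Proof. exact: ge0_integral_law_of. Qed.

Lemma mean_class_reflection mu P :
  mean_class phi B mu P -> mean_class phi B (- mu)%R (reflection P).
Proof.
move=> [iP mP bP].
have iN : P.-integrable setT (EFin \o (fun x => - x)%R).
  by rewrite (_ : _ \o _ = \- EFin)//; exact: integrableN.
have mE : measurable_fun setT (EFin : R -> \bar R) by exact: measurable_int iP.
split.
- exact: integrable_law_of.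
- rewrite integral_law_of//.
  under eq_integral do rewrite -mulN1r EFinM.
  by rewrite integralZl// mP -EFinM mulN1r.
- rewrite ge0_integral_reflection//; last 2 first.
  + exact/measurable_EFinP.
  + by move=> x; rewrite lee_fin.
  by under eq_integral do rewrite -opprD phi_even.
Qed.

(** Dominated convergence with a constant bound: since [harmonic n <= 1], the argument of [phi] has
    absolute value at most [M + |mu| + 1] on the window. *)
Lemma integral_window_cvg_right P mu M :
  \int[P]_(x in window M) (phi (x - (mu + harmonic n)))%:E @[n --> \oo] -->
  \int[P]_(x in window M) (phi (x - mu))%:E.
Proof.
have mw := measurable_window M.
have PMfin : P (window M) < +oo.
  by rewrite (le_lt_trans (probability_le1 P mw))// ltry.
have := (@dominated_convergence _ _ _ P (window M) mw
  (fun n x => (phi (x - (mu + harmonic n)))%:E) (fun x => (phi (x - mu))%:E)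
  (cst (phi (M + `|mu| + 1))%:E) _ _ _ _ _) => -[]//.
- by move=> n; apply/measurable_EFinP; exact: measurable_funTS.
- by apply/measurable_EFinP; exact: measurable_funTS.
- apply: aeW => x _; apply: cvg_EFin; first exact: nearW.
  apply: continuous_cvg; first exact: phi_cont.
  rewrite -[in X in _ --> X](addr0 mu).
  apply: cvgB; first exact: cvg_cst.
  by apply: cvgD; [exact: cvg_cst|exact: cvg_harmonic].
- by apply: measurable_bounded_integrable => //; exact: bounded_cst.
- apply: aeW => x n xM; rewrite abse_EFin lee_fin ger0_norm// phi_le//.
  rewrite (le_trans (ler_normB _ _))// -addrA lerD//.
  rewrite (le_trans (ler_normD _ _))// lerD2l /harmonic ger0_norm ?invr_ge0//.
  by rewrite invf_le1 ?ler1n.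
Qed.

(* [phi (x - mu - h)] may fail to be [P]-integrable for every [h > 0], so [P] is
   truncated before its mean is moved: [Q] mixes the truncation of [P], whose tail
   mass is put at a point [c], with the point mass at the same [c], chosen so that
   the mean of [Q] is [mu + h]. *)
Lemma mean_class_shift mu P t : (0 < t < 1)%R -> mean_class phi B mu P ->
  \forall n \near \oo, exists2 h, (0 < h)%R &
  exists2 Q : probability R R, mean_class phi B (mu + h) Q &
    forall f : R -> \bar R, measurable_fun setT f -> (forall x, 0 <= f x) ->
      (1 - t)%:E * \int[P]_(x in window n%:R) f x <= \int[Q]_x f x.
Proof.
move=> /andP[t0 t1] [iP mP bP].
have t1' : (0 < 1 - t)%R by rewrite subr_gt0.
(* Here [e] is the tail mass, and [I] and [J] are the first moment and the [phi] moment about [c] on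
   the window. The mass of [Q] coming from the tail and from the atom is [s], and [m n h] solves (1
   - t) I + s c = mu + h for the point [c]. *)
pose e n := fine (P (~` window n%:R)).
pose I n := fine (\int[P]_(x in window n%:R) x%:E).
pose J n c := fine (\int[P]_(x in window n%:R) (phi (x - c))%:E).
pose s n := (t + (1 - t) * e n)%R.
pose m n h := ((mu + h - (1 - t) * I n) / s n)%R.
have mw n : measurable (window (n%:R : R)) by exact: measurable_window.
have efin n : P (~` window n%:R) = (e n)%:E.
  by rewrite fineK// fin_num_measure//; exact: measurableC.
have Ifin n : \int[P]_(x in window n%:R) x%:E = (I n)%:E.
  by rewrite fineK// integrable_fin_num//; exact: integrableS iP.
have bd n c x : window n%:R x -> (`|phi (x - c)| <= phi (n%:R + `|c|))%R.
  move=> xn; rewrite ger0_norm// phi_le// (le_trans (ler_normB _ _))//.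
  by rewrite lerD2r.
have Jfin n c : \int[P]_(x in window n%:R) (phi (x - c))%:E = (J n c)%:E.
  by rewrite fineK// integrable_fin_num//; exact: integrable_window (@bd n c).
have Icvg : I n @[n --> \oo] --> mu.
  by have := cvg_integral_window iP; rewrite mP => /fine_cvgP[].
have ecvg : e n @[n --> \oo] --> (0 : R)%R.
  have : P.-integrable setT (EFin \o cst (1%R : R)).
    by apply: measurable_bounded_integrable => //;
      [rewrite (le_lt_trans (probability_le1 P measurableT))// ltry|exact: bounded_cst].
  have oneE D : measurable D -> \int[P]_(x in D) (cst (1%R : R) x)%:E = P D.
    by move=> mD; rewrite -[RHS]mul1e -(integral_cst P mD).
  move=> /cvg_integral_window; rewrite oneE// probability_setT.
  under eq_fun do rewrite oneE//.
  move=> /fine_cvgP[_ H].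
  have -> : e = (fun n => 1 - fine (P (window n%:R)))%R.
    by apply/funext => n; rewrite /e probability_setC// fineB ?fin_num_measure.
  rewrite (_ : nbhs (0%R : R) = nbhs (1 - 1 : R)%R); last by rewrite subrr.
  by apply: cvgB; [exact: cvg_cst|exact: H].
have e0 n : (0 <= e n)%R by rewrite fine_ge0.
have s0 n : (0 < s n)%R by rewrite ltr_wpDr// mulr_ge0// ltW.
have scvg : s n @[n --> \oo] --> t.
  rewrite (_ : nbhs t = nbhs (t + (1 - t) * 0)%R); last by rewrite mulr0 addr0.
  apply: cvgD; first exact: cvg_cst.
  by apply: cvgM; first exact: cvg_cst.
have mcvg : m n 0%R @[n --> \oo] --> mu.
  rewrite (_ : nbhs mu = nbhs ((mu + 0 - (1 - t) * mu) / t)%R); last first.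
    by congr nbhs; field; rewrite gt_eqF.
  apply: cvgM; last by apply: cvgV; rewrite ?gt_eqF.
  apply: cvgB; first exact: cvg_cst.
  by apply: cvgM => //; exact: cvg_cst.
(* At [h = 0] the point [m n 0] tends to [mu], so the [phi] moment of the mixture is asymptotically
   at most (1 - t) B + t phi(0). This is below [B] because phi(0) < B, and the slack pays for the
   displacement. *)
have Gcvg : ((1 - t) * B + s n * phi (m n 0 - mu))%R @[n --> \oo] -->
    ((1 - t) * B + t * phi 0)%R.
  apply: cvgD; first exact: cvg_cst.
  apply: cvgM => //; apply: continuous_cvg; first exact: phi_cont.
  rewrite (_ : nbhs (0%R : R) = nbhs (mu - mu)%R); last by rewrite subrr.
  by apply: cvgB => //; exact: cvg_cst.
have GB : ((1 - t) * B + t * phi 0 < B)%R.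
  by rewrite -ltrBrDl -[X in (_ < X - _)%R]mul1r -mulrBl opprB addrC subrK ltr_pM2l.
apply: (filterS _ (cvgr_lt _ Gcvg _ GB)) => n nB.
(* Now [n] is fixed and the displacement tends to 0 along [harmonic k]: the strict inequality at
   displacement 0 persists for some positive one. *)
have mhcvg : m n (harmonic k) @[k --> \oo] --> m n 0%R.
  apply: cvgM; last exact: cvg_cst.
  apply: cvgB; last exact: cvg_cst.
  by apply: cvgD; [exact: cvg_cst|exact: cvg_harmonic].
have Jcvg : J n (mu + harmonic k)%R @[k --> \oo] --> J n mu.
  have := @integral_window_cvg_right P mu n%:R.
  by rewrite Jfin => /fine_cvgP[].
have Fcvg : ((1 - t) * J n (mu + harmonic k) +
      s n * phi (m n (harmonic k) - (mu + harmonic k)))%R @[k --> \oo] -->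
    ((1 - t) * J n mu + s n * phi (m n 0 - (mu + 0)))%R.
  apply: cvgD; first by apply: cvgM => //; exact: cvg_cst.
  apply: cvgM; first exact: cvg_cst.
  apply: continuous_cvg; first exact: phi_cont.
  apply: cvgB => //.
  by apply: cvgD; [exact: cvg_cst|exact: cvg_harmonic].
have FB : ((1 - t) * J n mu + s n * phi (m n 0 - (mu + 0)) < B)%R.
  apply: le_lt_trans nB; rewrite addr0 lerD2r ler_wpM2l ?(ltW t1')//.
  rewrite -lee_fin -Jfin; apply: le_trans bP.
  apply: ge0_subset_integral => //.
  - exact/measurable_EFinP.
  - by move=> x _; rewrite lee_fin.
have [k kB] := filter_ex (cvgr_lt _ Fcvg _ FB).
set h : R := harmonic k in kB.
have h0 : (0 < h)%R by rewrite /h /harmonic invr_gt0 ltr0n.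
exists h => //.
pose c := m n h.
exists (mixture (ltW t0) (ltW t1) (\d_ c) (law_of (measurable_clip n%:R c) P)).
  (* The mean and the [phi] moment are both integrals of functions bounded on the window, so one
     computation serves for the two. *)
  have main (F : R -> R) K : measurable_fun setT F ->
      (forall x, window n%:R x -> `|F x| <= K)%R ->
      [/\ (\d_ c : probability R R).-integrable setT (EFin \o F),
        (law_of (measurable_clip n%:R c) P).-integrable setT (EFin \o F) &
        forall a : R, \int[P]_(x in window n%:R) (F x)%:E = a%:E ->
        \int[mixture (ltW t0) (ltW t1) (\d_ c)
          (law_of (measurable_clip n%:R c) P)]_x (F x)%:E =
        ((1 - t) * a + s n * F c)%:E].
    move=> mF FK; have mEF : measurable_fun setT (EFin \o F) by exact/measurable_EFinP.
    have i1 : (\d_ c : probability R R).-integrable setT (EFin \o F).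
      apply/integrableP; split => //; rewrite integral_dirac//; last first.
        exact: measurableT_comp.
      by rewrite diracT mul1e abse_EFin ltry.
    have i2 : (law_of (measurable_clip n%:R c) P).-integrable setT (EFin \o F).
      by apply: integrable_law_of => //; exact: integrable_clip FK.
    split => // a aE.
    rewrite (integral_mixture _ _ i1 i2) integral_dirac// diracT mul1e.
    rewrite integral_law_of//; last exact: integrable_clip FK.
    rewrite (integral_clip _ _ mF FK) aE efin -!(EFinM, EFinD); congr EFin.
    by rewrite /s; ring.
  split.
  - have [i1 i2 _] := main id n%:R (@measurable_id _ _ _) (fun x xn => xn).
    exact: integrable_mixture.
  - have [_ _ /(_ _ (Ifin n)) ->] := main id n%:R (@measurable_id _ _ _) (fun x xn => xn).
    congr EFin; rewrite /= /c /m mulrCA divff ?mulr1 ?gt_eqF//.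
    by rewrite addrC subrK.
  - have [_ _ /(_ _ (Jfin n _)) ->] := main _ _ (measurable_phiB (mu + h)) (@bd n (mu + h)%R).
    by rewrite lee_fin ltW.
move=> f mf f0; rewrite ge0_integral_mixture//.
apply: (@le_trans _ _ ((1 - t)%:E *
    \int[law_of (measurable_clip n%:R c) P]_x f x)); last first.
  by rewrite leeDr// mule_ge0 ?lee_fin ?(ltW t0)// integral_ge0.
rewrite lee_wpmul2l ?lee_fin ?(ltW t1')// ge0_integral_law_of//.
rewrite [leLHS](_ : _ = \int[P]_(x in window n%:R) f (clip n%:R c x)); last first.
  by apply: eq_integral => x; rewrite inE /clip /window /= => ->.
apply: ge0_subset_integral => //.
by apply: measurableT_comp => //; exact: measurable_clip.
Qed.

End mean_class_theory.

(** * Symmetrization *)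

Section symmetrization.
Local Open Scope ereal_scope.
Context (R : realType).
Implicit Types (P Q w : probability R R).

Lemma mixture_dominates d (T : measurableType d) (t : R) (t0 : (0 <= t)%R)
    (t1 : (t <= 1)%R) (P Q : probability T R) : (0 < t < 1)%R ->
  P `<< mixture t0 t1 P Q /\ Q `<< mixture t0 t1 P Q.
Proof.
move=> /andP[t_gt0 t_lt1].
have mixE A : mixture t0 t1 P Q A = t%:E * P A + (1 - t)%:E * Q A.
  by rewrite /mixture measure_addE.
have mix0 A : mixture t0 t1 P Q A = 0 -> P A = 0 /\ Q A = 0.
  rewrite mixE => /eqP; rewrite padde_eq0 ?mule_ge0 ?lee_fin ?subr_ge0// !mule_eq0 !eqe.
  by rewrite subr_eq0 (gt_eqF t_gt0) (gt_eqF t_lt1)/= => /andP[/eqP-> /eqP->].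
by split; apply/null_content_dominatesP => A mA /mix0[].
Qed.

Definition has_density w P (p : R -> R) := [/\ measurable_fun [set: R] p,
  forall x, (0 <= p x)%R &
  forall h : R -> \bar R, measurable_fun setT h -> (forall x, 0 <= h x) ->
    \int[w]_x ((p x)%:E * h x) = \int[P]_x h x].

Lemma measurable_sqrtM d (T : measurableType d) (f g : T -> R) :
  measurable_fun setT f -> measurable_fun setT g ->
  measurable_fun setT (fun x => Num.sqrt (f x * g x)).
Proof.
move=> mf mg; apply: (@measurableT_comp _ _ _ _ _ _ (@Num.sqrt R) _ (f \* g)%R).
  by apply: continuous_measurable_fun; exact: sqrt_continuous.
exact: measurable_funM.
Qed.

Lemma hellinger_affinity_density w P Q : P `<< w -> Q `<< w ->
  exists p q, [/\ has_density w P p, has_density w Q q &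
    hellinger_affinity P Q = \int[w]_x (Num.sqrt (p x * q x))%:E].
Proof.
move=> Pw Qw.
pose D P := Radon_Nikodym_SigmaFinite.f P w.
have Dfin P' x : P' `<< w -> D P' x \is a fin_num.
  by move=> H; exact: Radon_Nikodym_SigmaFinite.f_fin_num.
have densD P' : P' `<< w -> has_density w P' (fine \o D P').
  move=> P'w; have mD : measurable_fun setT (D P').
    exact: measurable_int (Radon_Nikodym_SigmaFinite.f_integrable P'w).
  split => [|x|h mh h0].
  - exact: measurableT_comp.
  - by apply: fine_ge0; exact: Radon_Nikodym_SigmaFinite.f_ge0.
  - rewrite -(Radon_Nikodym_SigmaFinite.change_of_variables P'w)//.
    by apply: eq_integral => x _; rewrite /= fineK ?Dfin// muleC.
have [mp p0 _] := densD _ Pw; have [mq q0 _] := densD _ Qw.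
exists (fine \o D P), (fine \o D Q); split; [exact: densD|exact: densD|].
rewrite (hellinger_affinityE Pw Qw) /hellinger_integral.
set dP := Radon_Nikodym (charge_of_finite_measure P) w.
set dQ := Radon_Nikodym (charge_of_finite_measure Q) w.
have dPfin x : dP x \is a fin_num by exact: Radon_Nikodym_fin_num.
have dQfin x : dQ x \is a fin_num by exact: Radon_Nikodym_fin_num.
have mdP : measurable_fun setT dP.
  by apply: measurable_int; exact: Radon_Nikodym_integrable.
have mdQ : measurable_fun setT dQ.
  by apply: measurable_int; exact: Radon_Nikodym_integrable.
have sE x : sqrte (dP x * dQ x) = (Num.sqrt (fine (dP x) * fine (dQ x)))%:E.
  by rewrite -{1}(fineK (dPfin x)) -{1}(fineK (dQfin x)).
(* The affinity and the densities use two versions of the Radon-Nikodym derivative, which are only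
   known to agree almost everywhere. *)
apply: ge0_ae_eq_integral => //.
- under eq_fun do rewrite sE.
  by apply/measurable_EFinP; apply: measurable_sqrtM; exact: measurableT_comp.
- by apply/measurable_EFinP; exact: measurable_sqrtM.
- by move=> x _; exact: sqrte_ge0.
have hP := ae_eq_Radon_Nikodym_SigmaFinite Pw measurableT.
have hQ := ae_eq_Radon_Nikodym_SigmaFinite Qw measurableT.
apply: filterS2 hP hQ => x /= hPx hQx _.
by rewrite sE /dP /dQ -hPx// -hQx.
Qed.

(** Cauchy-Schwarz in the plane for (sqrt a, sqrt b) and (sqrt d, sqrt c); squared, it is the
    inequality of the two means for ac and bd. *)
Lemma sqrt_mulD_ge (a b c d : R) : (0 <= a)%R -> (0 <= b)%R -> (0 <= c)%R ->
  (0 <= d)%R ->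
  (Num.sqrt (a * d) + Num.sqrt (b * c) <= Num.sqrt ((c + d) * (a + b)))%R.
Proof.
move=> a0 b0 c0 d0; rewrite -ler_sqr ?nnegrE ?addr_ge0 ?sqrtr_ge0//.
rewrite sqrrD !sqr_sqrtr ?mulr_ge0 ?addr_ge0// -mulr_natl -sqrtrM ?mulr_ge0//.
suff : (2 * Num.sqrt (a * d * (b * c)) <= a * c + b * d)%R by lra.
rewrite (_ : (a * d * (b * c) = (a * c) * (b * d))%R); last by ring.
rewrite sqrtrM ?mulr_ge0//.
rewrite -{2}(sqr_sqrtr (mulr_ge0 a0 c0)) -{2}(sqr_sqrtr (mulr_ge0 b0 d0)).
have := sqr_ge0 (Num.sqrt (a * c) - Num.sqrt (b * d)); lra.
Qed.

(** Over a reflection-invariant [w], the reflection of a law with density [q] has density [q (- x)].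
    A single function thus carries the symmetrized pair, and the right side is the affinity of that
    pair. *)
Lemma symmetric_density Pm Pp (half0 : (0 <= 2^-1 :> R)%R)
    (half1 : (2^-1 <= 1 :> R)%R) :
  exists w q, [/\
    forall h : R -> \bar R, measurable_fun setT h -> (forall x, 0 <= h x) ->
      \int[w]_x h (- x)%R = \int[w]_x h x,
    has_density w (mixture half0 half1 Pp (reflection Pm)) q &
    hellinger_affinity Pm Pp <= \int[w]_x (Num.sqrt (q (- x) * q x))%:E].
Proof.
have halfE : (1 - 2^-1 = 2^-1 :> R)%R by lra.
have half01 : (0 < (2^-1 : R) < 1)%R by lra.
(* The average [w0] dominates both laws, and averaging it with its own reflection makes [w]
   invariant. *)
pose w0 : probability R R := mixture half0 half1 Pm Pp.
pose w : probability R R := mixture half0 half1 w0 (reflection w0).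
have mN (h : R -> \bar R) : measurable_fun setT h ->
    measurable_fun [set: R] (fun x => h (- x)%R).
  by move=> mh; apply: measurableT_comp => //; exact: oppr_measurable.
have winv (h : R -> \bar R) : measurable_fun setT h -> (forall x, 0 <= h x) ->
    \int[w]_x h (- x)%R = \int[w]_x h x.
  move=> mh h0; rewrite !(ge0_integral_mixture half0 half1 w0 (reflection w0))//; try exact: mN.
  rewrite !ge0_integral_reflection//; last exact: mN.
  under [X in _ + _ * X = _]eq_integral do rewrite opprK.
  by rewrite halfE addeC.
have [Pm0 Pp0] := mixture_dominates half0 half1 Pm Pp half01.
have [w0w _] := mixture_dominates half0 half1 w0 (reflection w0) half01.
have Pmw : Pm `<< w by exact: null_dominates_trans w0w.
have Ppw : Pp `<< w by exact: null_dominates_trans w0w.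
have [pm [pp [[mpm pm0 pmP] [mpp pp0 ppP] ->]]] := hellinger_affinity_density Pmw Ppw.
have mNr (h : R -> R) : measurable_fun setT h ->
    measurable_fun [set: R] (fun x => h (- x)%R).
  by move=> mh; apply: measurableT_comp => //; exact: oppr_measurable.
pose q x := (2^-1 * pp x + 2^-1 * pm (- x))%R.
have mq : measurable_fun [set: R] q.
  by apply: measurable_funD; apply: measurable_funM => //; exact: mNr.
have q0 x : (0 <= q x)%R by rewrite addr_ge0// mulr_ge0.
exists w, q; split => //.
  split => // h mh h0.
  rewrite (ge0_integral_mixture half0 half1 Pp (reflection Pm))//.
  rewrite ge0_integral_reflection// -ppP//.
  rewrite -(pmP (fun x => h (- x)%R))//; last exact: mN.
  rewrite -(winv (fun x => (pm x)%:E * h (- x)%R))//; last 2 first.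
  - by apply: emeasurable_funM; [exact/measurable_EFinP|exact: mN].
  - by move=> x; rewrite mule_ge0 ?lee_fin.
  rewrite -!ge0_integralZl ?lee_fin ?subr_ge0//; last 4 first.
  - apply: emeasurable_funM; first by apply/measurable_EFinP; exact: mNr.
    by under eq_fun do rewrite opprK.
  - by move=> x _; rewrite mule_ge0 ?lee_fin.
  - by apply: emeasurable_funM => //; exact/measurable_EFinP.
  - by move=> x _; rewrite mule_ge0 ?lee_fin.
  rewrite -ge0_integralD//; last 4 first.
  - by move=> x _; rewrite !mule_ge0 ?lee_fin.
  - apply: emeasurable_funM => //.
    by apply: emeasurable_funM => //; exact/measurable_EFinP.
  - by move=> x _; rewrite !mule_ge0 ?lee_fin ?subr_ge0.
  - apply: emeasurable_funM => //.
    apply: emeasurable_funM; first by apply/measurable_EFinP; exact: mNr.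
    by under eq_fun do rewrite opprK.
  apply: eq_integral => x _; rewrite opprK /q.
  rewrite halfE !muleA -!EFinM -ge0_muleDl ?lee_fin ?mulr_ge0//.
pose s x := Num.sqrt (pm x * pp x).
have ms1 : measurable_fun [set: R] s by exact: measurable_sqrtM.
(* Invariance of [w] allows the integrand to be averaged with its reflection, after which
   Cauchy-Schwarz applies pointwise to [pp x], [pm (- x)], [pp (- x)], [pm x]. *)
have -> : \int[w]_x (s x)%:E =
    \int[w]_x (2^-1 * s x + 2^-1 * s (- x))%:E.
  rewrite ge0_integral_affine2//; first last.
  - by move=> x; exact: sqrtr_ge0.
  - by move=> x; exact: sqrtr_ge0.
  - exact: mNr.
  rewrite (winv (EFin \o s)); last 2 first.
  - exact/measurable_EFinP.
  - by move=> x; rewrite lee_fin sqrtr_ge0.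
  rewrite -ge0_muleDl ?lee_fin// -EFinD.
  by rewrite (_ : 2^-1 + 2^-1 = 1 :> R)%R ?mul1e//; lra.
apply: ge0_le_integral => //.
- by move=> x _; rewrite lee_fin addr_ge0// mulr_ge0// sqrtr_ge0.
- apply/measurable_EFinP; apply: measurable_funD; apply: measurable_funM => //.
  exact: mNr.
- by apply/measurable_EFinP; apply: measurable_sqrtM => //; exact: mNr.
- move=> x _; rewrite lee_fin /q opprK.
  have := sqrt_mulD_ge (pp0 x) (pm0 (- x)%R) (pp0 (- x)%R) (pm0 x).
  rewrite /s -mulrDr [(pm x * _)%R]mulrC => /(ler_wpM2l half0) /le_trans; apply.
  by rewrite -!mulrDr mulrACA -expr2 [leRHS]sqrtrM ?sqr_ge0// sqrtr_sqr ger0_norm.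
Qed.

End symmetrization.

(** * The lower bound *)

Section limits.
Local Open Scope ereal_scope.
Context (R : realType).

Lemma limn_einf_ge (u : (\bar R)^nat) (c : \bar R) :
  (\forall n \near \oo, c <= u n) -> c <= limn_einf u.
Proof.
move=> [N _ uN]; rewrite limn_einf_lim.
apply: lime_ge; first exact: is_cvg_einfs.
exists N => // n /= Nn; apply: le_ereal_inf_tmp => _ [k /= nk <-].
by apply: uN => /=; exact: leq_trans nk.
Qed.

(** Left continuity of the logarithm: a finite positive supremum s is approached by s e^(-eps), and
    an infinite one by e^a. A supremum at most 0, such as that of the empty set, has logarithm
    [-oo]. *)
Lemma lne_ereal_sup_le (S : set (\bar R)) (x : \bar R) :
  (forall r : R, (0 < r)%R -> r%:E < ereal_sup S -> (ln r)%:E <= x) ->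
  lne (ereal_sup S) <= x.
Proof.
case: (ereal_sup S) => [s| |] H; last by rewrite leNye.
  have [s0|s0] := leP s 0%R; first by rewrite le0_lneNy ?leNye.
  rewrite lne_EFin//; apply/lee_subgt0Pr => e e0.
  have := H (s * expR (- e))%R; rewrite mulr_gt0 ?expR_gt0// lte_fin.
  rewrite lnM ?posrE ?expR_gt0// expRK EFinD EFinN; apply => //.
  by rewrite gtr_pMr// -expR0 ltr_expR oppr_lt0.
have -> : x = +oo; last by rewrite leey.
apply/eqyP => a _.
by have := H (expR a); rewrite expR_gt0 ltry expRK; exact.
Qed.

End limits.

Section robust_lower_bound.
Local Open Scope ereal_scope.
Context (R : realType) (phi : R -> R) (B : R).
Hypotheses (phi_ge0 : forall x, (0 <= phi x)%R)
  (phi_even : forall x, phi (- x)%R = phi x) (phi_cont : continuous phi)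
  (phi_ndecr : forall x y : R, (0 <= x)%R -> (x <= y)%R -> (phi x <= phi y)%R)
  (phi0_ltB : (phi 0%R < B)%R).
Variables (Delta : R) (est : forall n : nat, n.-tuple R -> R).
Hypothesis est_meas : forall n : nat, (1 <= n)%N ->
  measurable_fun [set: n.-tuple R] (est (n := n)).

Lemma worst_case_confidence_ge n h (P Q : probability R R) (c : R) :
  (1 <= n)%N -> (0 < h)%R ->
  mean_class phi B (- (Delta + h))%R P -> mean_class phi B (Delta + h) Q ->
  (forall A : set (n.-tuple R), measurable A ->
    c%:E <= iid_law P n A + iid_law Q n (~` A)) ->
  (2^-1 * c)%:E <= worst_case_confidence phi B (est (n := n)) Delta.
Proof.
move=> n1 h0 CP CQ cPQ; set beta := worst_case_confidence _ _ _ _.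
have mest := est_meas n1.
have mgt a : measurable [set x : n.-tuple R | (a < est x)%R].
  rewrite -[X in measurable X]setTI.
  by apply: measurable_fun_ltr => //; exact: measurable_cst.
have mlt a : measurable [set x : n.-tuple R | (est x < a)%R].
  rewrite -[X in measurable X]setTI.
  by apply: measurable_fun_ltr => //; exact: measurable_cst.
(* As -h = -(Delta + h) + Delta, this is the overshoot event under [P]. Off [A] one has est <= -h <
   h = (Delta + h) - Delta, an undershoot under [Q]; the larger of the two errors is at least half
   their sum. *)
pose A := [set x : n.-tuple R | (- h < est x)%R].
have PA : iid_law P n A <= beta.
  rewrite /beta /worst_case_confidence le_max; apply/orP; left.
  apply: ereal_sup_ubound; exists (- (Delta + h))%R, P; split => //.
  by rewrite (_ : - (Delta + h) + Delta = - h)%R//; ring.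
have QA : iid_law Q n (~` A) <= beta.
  apply: (@le_trans _ _ (iid_law Q n [set x | (est x < h)%R])).
    apply: le_measure; rewrite ?inE; [|exact: mlt|].
      by apply: measurableC; exact: mgt.
    by move=> x /negP; rewrite -leNgt => /le_lt_trans; apply; lra.
  rewrite /beta /worst_case_confidence le_max; apply/orP; right.
  apply: ereal_sup_ubound; exists (Delta + h)%R, Q; split => //.
  by rewrite (_ : Delta + h - Delta = h)%R//; ring.
have := le_trans (cPQ A (mgt _)) (leeD PA QA).
have : 0 <= beta by apply: le_trans PA.
case: beta {PA QA} => [b| |]; [|by move=> *; exact: leey|by []].
by rewrite -EFinD !lee_fin => _ H; lra.
Qed.

(** Only the right-hand law of the symmetrized pair is truncated and shifted; reflecting the result
    supplies its partner, so symmetry is kept. The constant [4^-1] is one half from testing times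
    one half from replacing the sum of errors by their maximum. *)
Lemma worst_case_confidence_lower_bound Pm Pp (r delta : R) : (0 < r)%R ->
  mean_class phi B (- Delta)%R Pm -> mean_class phi B Delta Pp ->
  r%:E < hellinger_affinity Pm Pp -> (0 < delta)%R ->
  \forall n \near \oo, (4^-1 * (expR (- (n%:R * delta)) * r ^+ n))%:E <=
    worst_case_confidence phi B (est (n := n)) Delta.
Proof.
move=> r0 CPm CPp rPmp d0.
have half0 : (0 <= 2^-1 :> R)%R by lra.
have half1 : (2^-1 <= 1 :> R)%R by lra.
have [w [q [winv [mq q0 qP] affq]]] := symmetric_density Pm Pp half0 half1.
set Q := mixture half0 half1 Pp (reflection Pm) in qP.
have CQ : mean_class phi B Delta Q.
  apply: mean_class_mixture => //.
  by rewrite -[Delta]opprK; exact: mean_class_reflection.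
pose s x := Num.sqrt (q (- x) * q x)%R.
have mN (f : R -> R) : measurable_fun setT f ->
    measurable_fun [set: R] (fun x => f (- x)%R).
  by move=> mf; apply: measurableT_comp => //; exact: oppr_measurable.
have mNe (f : R -> \bar R) : measurable_fun setT f ->
    measurable_fun [set: R] (fun x => f (- x)%R).
  by move=> mf; apply: measurableT_comp => //; exact: oppr_measurable.
have ms : measurable_fun [set: R] s by apply: measurable_sqrtM => //; exact: mN.
have mes : measurable_fun [set: R] (fun x => (s x)%:E) by exact/measurable_EFinP.
have s0 x : (0 <= s x)%R by exact: sqrtr_ge0.
have rs : r%:E < \int[w]_x (s x)%:E by exact: lt_le_trans affq.
have [r1 rr1 r1s] : exists2 r1 : R, (r < r1)%R & r1%:E < \int[w]_x (s x)%:E.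
  move: rs; case: (integral _ _ _) => [a| |]//.
    by rewrite lte_fin => ra; exists ((r + a) / 2)%R; rewrite ?lte_fin; lra.
  by move=> _; exists (r + 1)%R; rewrite ?ltry//; lra.
have r10 : (0 < r1)%R by lra.
(* The window retains affinity at least [r1] and mixing multiplies it by [1 - t]; this choice leaves
   exactly (1 - t) r1 = r. *)
pose t := (1 - r / r1)%R.
have t01 : (0 < t < 1)%R.
  by rewrite subr_gt0 ltr_pdivrMr// mul1r rr1 gtrBl divr_gt0.
have t1' : (1 - t = r / r1)%R by rewrite /t; ring.
have t0' : (0 <= 1 - t)%R by rewrite t1' divr_ge0// ltW.
have swin : \int[w]_(x in window n%:R) (s x)%:E @[n --> \oo] -->
    \int[w]_x (s x)%:E.
  rewrite -(_ : \bigcup_n window (n%:R : R) = setT); last first.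
    apply/seteqP; split => // x _.
    by have [N _ /(_ N (leqnn N)) xN] := nbhs_infty_ger `|x|%R; exists N.
  apply: ge0_nondecreasing_set_cvg_integral => //.
  - move=> m n mn; apply/subsetPset => x /le_trans; apply.
    by rewrite ler_nat.
  - by move=> n; exact: measurable_window.
  - by move=> n; exact: measurable_funTS.
  - by move=> n x _; rewrite lee_fin.
have [n [r1n [h h0 [Q' CQ' QQ']]]] : exists n,
    r1%:E <= \int[w]_(x in window n%:R) (s x)%:E /\
    exists2 h, (0 < h)%R &
    exists2 Q' : probability R R, mean_class phi B (Delta + h) Q' &
    forall f : R -> \bar R, measurable_fun setT f -> (forall x, 0 <= f x) ->
      (1 - t)%:E * \int[Q]_(x in window n%:R) f x <= \int[Q']_x f x.
  have H1 := mean_class_shift phi_ge0 phi_even phi_cont phi_ndecr phi0_ltB t01 CQ.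
  have H2 : \forall n \near \oo, r1%:E <= \int[w]_(x in window n%:R) (s x)%:E.
    have [N _ HN] := swin _ (open_ereal_gt' r1s).
    by exists N => // n Nn; exact/ltW/HN.
  by have [n [Hn1 Hn2]] := filter_ex (filterI H2 H1); exists n.
have mw : measurable (window (n%:R : R)) by exact: measurable_window.
pose chi (x : R) : R := \1_(window n%:R) x.
have mchi : measurable_fun [set: R] chi by exact: measurable_indic.
have chi0 x : (0 <= chi x)%R by rewrite /chi.
have chiN x : chi (- x)%R = chi x.
  rewrite /chi !indicE; congr (nat_of_bool _)%:R.
  by apply/idP/idP => /set_mem H; apply/mem_set; move: H; rewrite /window /= normrN.
(* The part of [Q'] that is controlled: [1 - t] times the restriction of [Q] to the window, as a
   density over [w]. *)
pose b x := ((1 - t) * (chi x * q x))%R.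
have mb : measurable_fun [set: R] b.
  by apply: measurable_funM => //; exact: measurable_funM.
have b0 x : (0 <= b x)%R by rewrite mulr_ge0// mulr_ge0.
have bQ' : subdensity w Q' b.
  split => // f mf f0; apply: le_trans (QQ' f mf f0).
  have mcf : measurable_fun [set: R] (fun x => (chi x)%:E * f x).
    by apply: emeasurable_funM => //; exact/measurable_EFinP.
  have -> : \int[Q]_(x in window n%:R) f x = \int[Q]_x ((chi x)%:E * f x).
    rewrite integral_mkcond; apply: eq_integral => x _.
    by rewrite patchE /chi indicE; case: ifP => _; rewrite ?mul1e ?mul0e.
  rewrite -qP//; last by move=> x; rewrite mule_ge0 ?lee_fin.
  rewrite -ge0_integralZl//; last 2 first.
  - by apply: emeasurable_funM => //; exact/measurable_EFinP.
  - by move=> x _; rewrite !mule_ge0 ?lee_fin.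
  rewrite le_eqVlt; apply/orP; left; apply/eqP.
  by apply: eq_integral => x _; rewrite /b !EFinM -!muleA; congr (_ * _); rewrite muleCA.
have aQ' : subdensity w (reflection Q') (fun x => b (- x)%R).
  split => [|//|f mf f0]; first exact: mN.
  rewrite ge0_integral_reflection//.
  have [_ _ bP] := bQ'.
  apply: le_trans (bP _ (mNe _ mf) (fun x => f0 _)).
  rewrite -(winv (fun x => (b x)%:E * f (- x)%R))//.
  - by under [leRHS]eq_integral do rewrite opprK.
  - by apply: emeasurable_funM; [exact/measurable_EFinP|exact: mNe].
  - by move=> x; rewrite mule_ge0 ?lee_fin.
(* The change of variable x -> -x exchanges the two densities, that is, it reverses the tilt. *)
have geo_sym (u : R) : \int[w]_x (geo_mean u (b (- x)%R) (b x))%:E =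
    \int[w]_x (geo_mean (- u) (b (- x)%R) (b x))%:E.
  rewrite -(winv (fun x => (geo_mean u (b (- x)%R) (b x))%:E)).
  - by apply: eq_integral => x _; rewrite opprK geo_meanC.
  - by apply/measurable_EFinP; apply: measurable_geo_mean => //; exact: mN.
  - by move=> x; rewrite lee_fin geo_mean_ge0.
have sE x : geo_mean 0 (b (- x)%R) (b x) = ((1 - t) * (chi x * s x))%R.
  rewrite geo_mean_sqrt// /b chiN /s.
  transitivity (Num.sqrt (((1 - t) * chi x) ^+ 2 * (q (- x) * q x)))%R.
    by congr Num.sqrt; move: (q (- x)%R) (q x) (chi x) => ? ? ?; ring.
  by rewrite sqrtrM ?sqr_ge0// sqrtr_sqr ger0_norm ?mulr_ge0// mulrA.
have affE : \int[w]_x (geo_mean 0 (b (- x)%R) (b x))%:E =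
    (1 - t)%:E * \int[w]_(x in window n%:R) (s x)%:E.
  rewrite -ge0_integralZl//; last 2 first.
  - exact: measurable_funTS.
  - by move=> x _; rewrite lee_fin.
  rewrite [RHS]integral_mkcond; apply: eq_integral => x _.
  rewrite sE patchE /chi indicE EFinM.
  by case: ifP => _; rewrite ?mul1r ?mul0r ?mule0.
have [rho rhoE] : exists rho : R,
    \int[w]_x (geo_mean 0 (b (- x)%R) (b x))%:E = rho%:E.
  exists (fine (\int[w]_x (geo_mean 0 (b (- x)%R) (b x))%:E)).
  rewrite fineK// ge0_fin_numE; last first.
    by apply: integral_ge0 => x _; rewrite lee_fin geo_mean_ge0.
  (* The geometric mean is at most the sum of the two subdensities, whose integral is finite. *)
  apply: (@le_lt_trans _ _ (\int[w]_x (1 * b (- x)%R + 1 * b x)%:E)).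
    apply: ge0_le_integral => //.
    - by move=> x _; rewrite lee_fin geo_mean_ge0.
    - by apply/measurable_EFinP; apply: measurable_geo_mean => //; exact: mN.
    - apply/measurable_EFinP; apply: measurable_funD; apply: measurable_funM => //.
      exact: mN.
    - move=> x _; rewrite lee_fin !mul1r geo_mean_sqrt//.
      rewrite -ler_sqr ?nnegrE ?sqrtr_ge0 ?addr_ge0// sqr_sqrtr ?mulr_ge0//.
      by have := b0 x; have := b0 (- x)%R; nra.
  rewrite ge0_integral_affine2//; last exact: mN.
  rewrite !mul1e lte_add_pinfty// (le_lt_trans _ (ltry 1))//.
    exact: subdensity_le1 aQ'.
  exact: subdensity_le1 bQ'.
have rrho : (r <= rho)%R.
  rewrite -lee_fin -rhoE affE.
  rewrite (_ : r = (1 - t) * r1)%R; last by rewrite t1' divfK ?gt_eqF.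
  by rewrite EFinM lee_wpmul2l ?lee_fin.
have rho0 : (0 < rho)%R by exact: lt_le_trans rrho.
have := testing_lower_bound aQ' bQ' geo_sym rhoE d0 rho0.
apply: filterS2 (nbhs_infty_ge 1) => k k1 Hk.
rewrite (_ : 4^-1 = 2^-1 * 2^-1 :> R)%R; last by field.
rewrite -mulrA; apply: (@worst_case_confidence_ge k h (reflection Q') Q' _ k1 h0 _ CQ').
  exact: mean_class_reflection.
move=> A mA; apply: le_trans (Hk A mA).
rewrite lee_fin ler_wpM2l// ler_wpM2l ?expR_ge0// lerXn2r ?nnegrE//; exact: ltW.
Qed.

End robust_lower_bound.

Theorem proposition2 (R : realType) (phi : R -> R) (B : R)
  (phi_ge0 : forall x : R, 0 <= phi x)
  (phi_even : forall x : R, phi (- x) = phi x)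
  (phi_cont : continuous phi)
  (phi_ndecr : forall x y : R, 0 <= x -> x <= y -> phi x <= phi y)
  (phi_superlinear_pinfty : phi x / `|x| @[x --> +oo] --> +oo)
  (phi_superlinear_ninfty : phi x / `|x| @[x --> -oo] --> +oo)
  (phi0_ltB : phi 0 < B)
  (Delta : R) (Delta_gt0 : 0 < Delta)
  (est : forall n : nat, n.-tuple R -> R)
  (est_meas : forall n : nat, (1 <= n)%N ->
     measurable_fun [set: n.-tuple R] (est n)) :
  (- hellinger_rate phi B Delta <=
   limn_einf (fun n : nat =>
     (n%:R^-1)%:E * lne (worst_case_confidence phi B (est n) Delta)))%E.
Proof.
rewrite /hellinger_rate oppeK.
apply: lne_ereal_sup_le => r r0 /ereal_sup_gt[_ [Pm [Pp [CPm CPp ->]]] rPmp].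
apply/lee_subgt0Pr => e e0; apply: limn_einf_ge.
(* Half of [e] is spent on the factor e^(-n delta) with delta = e/2; the other half absorbs the
   constant [4^-1] as soon as n >= ln 4 / (e/2). *)
have e20 : 0 < e / 2 by rewrite divr_gt0.
have H := worst_case_confidence_lower_bound phi_ge0 phi_even phi_cont phi_ndecr
  phi0_ltB est_meas r0 CPm CPp rPmp e20.
have H4 := nbhs_infty_ger (ln 4 / (e / 2)).
move: (nbhs_infty_gt 0) H4 H; apply: filterS3 => n n0 n4 Hn.
have n0' : 0 < n%:R :> R by rewrite ltr0n.
set c := 4^-1 * _ in Hn.
have c0 : 0 < c by rewrite !mulr_gt0 ?expR_gt0 ?exprn_gt0.
apply: (@le_trans _ _ ((n%:R^-1)%:E * lne c%:E)%E); last first.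
  rewrite lee_wpmul2l ?lee_fin ?invr_ge0// lee_lne//.
    by rewrite in_itv /= lee_fin ltW//= leey.
  by rewrite in_itv /= leey andbT (le_trans _ Hn)// lee_fin ltW.
rewrite lne_EFin// -EFinM -EFinB lee_fin mulrC ler_pdivlMr//.
rewrite /c !lnM ?posrE ?mulr_gt0 ?expR_gt0 ?exprn_gt0// lnV ?posrE// expRK lnXn//.
move: n4; rewrite ler_pdivrMr// -mulr_natl.
lra.
Qed.
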